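(* Let $m\ge 2$, let $p_1,\dots,p_m$ be $p$-values (random variables with values in $[0,1]$) for null hypotheses $H_{01},\dots,H_{0m}$, let $I_0\subseteq\{1,\dots,m\}$ be the set of indices of the true null hypotheses, and let $\mathbb{P}(p_i\le u)\le u$ for all $i\in I_0$ and $u\in[0,1]$. Let $\alpha>0$, and let $1\le s_1\le s_2\le\dots\le s_m\le m$ be a non-decreasing shape sequence. Assume that $p_1,\dots,p_m$ are independent random variables and that non-negative weights $w_1,\dots,w_m$ are given. Then the step-up procedure with threshold sequence $t_r=s_r\alpha/m$ $(r=1,\dots,m)$ applied to $q_1,\dots,q_m$, where $q_i=p_i/w_i$ if $w_i>0$ and $q_i=1$ if $w_i=0$, satisfies $$\mathrm{pFDR}=\mathbb{E}\left[\frac{\mathit{FP}}{s_R}\,\mathbf{1}\{R>0\}\right]\le \frac{\alpha}{m}\sum_{i=1}^m w_i .$$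
   Context: Let $q_{(1)}\le\dots\le q_{(m)}$ be the ordered values of $q_1,\dots,q_m$. The step-up procedure with non-decreasing threshold sequence $t_1\le\dots\le t_m$ applied to $q_1,\dots,q_m$ is defined by $R=\max\{r\in\{1,\dots,m\}: q_{(r)}\le t_r\}$, with $R=0$ if no such $r$ exists; it rejects no hypothesis if $R=0$, and if $R\ge1$ it rejects exactly the hypotheses $H_{0i}$ with $q_i\le t_R$ (there are exactly $R$ of them). $R$ is the number of rejections and $\mathit{FP}$ denotes the number of rejected hypotheses with index in $I_0$ (false positives). The penalized false discovery proportion is $\mathit{pFDP}=\mathit{FP}/s_R$ if $R\ge1$ and $0$ otherwise, and the penalized false discovery rate is $\mathrm{pFDR}=\mathbb{E}(\mathit{pFDP})$. The weights are deterministic (fixed a priori).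
   Formalization: Added assumption: if some true null has weight w_i=0, then t_m = s_m α/m < 1 (automatic for α<1). Without it the claim fails: m=2, both nulls true, w=(0,0), s=(1,1), α=2 gives q_i=1=t_r, R=FP=2, pFDR=2>0. *)

(* Defs.v *)
(* MathComp-Analysis *)
From HB Require Import structures.
From mathcomp Require Import all_boot all_order all_algebra.
From mathcomp Require Import all_classical all_reals all_analysis.

Set Implicit Arguments.
Unset Strict Implicit.
Unset Printing Implicit Defensive.

Import Order.TTheory GRing.Theory Num.Theory.
Import numFieldNormedType.Exports.

Local Open Scope classical_set_scope.
Local Open Scope ring_scope.

(* Mutual independence of a finite family: the product rule over every
   subfamily J and all Borel sets. *)
Definition independent_RVs (d : measure_display) (T : measurableType d)
    (R : realType) (P : probability T R) (m : nat)
    (X : 'I_m -> {RV P >-> R}) : Prop :=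
  forall (J : {set 'I_m}) (B : 'I_m -> set R),
    (forall i, measurable (B i)) ->
    P [set x | forall i, i \in J -> B i (X i x)]
    = (\prod_(i in J) P (X i @^-1` B i))%E.

Section StepUp.
Variables (R : realType) (m : nat).
Implicit Types (q : 'I_m -> R) (t s : nat -> R) (r : nat).

(* q_(r), with r = 1, ..., m. *)
Definition order_stat q r : R :=
  nth 0 (sort <=%R [seq q i | i : 'I_m]) r.-1.

(* Sequences t_1, ..., t_m and s_1, ..., s_m are functions on nat of which only
   the values at 1, ..., m are used.  The maximum of an empty family is 0. *)
Definition num_rejections t q : nat :=
  \max_(1 <= r < m.+1 | order_stat q r <= t r) r.

Definition rejected t q : {set 'I_m} :=
  [set i | (0 < num_rejections t q)%N && (q i <= t (num_rejections t q))]%SET.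

Definition false_positives (I0 : {set 'I_m}) t q : nat := #|rejected t q :&: I0|.

Definition pFDP (I0 : {set 'I_m}) s t q : R :=
  if (0 < num_rejections t q)%N
  then (false_positives I0 t q)%:R / s (num_rejections t q)
  else 0.

(* Pitfall: the value 1 is rejectable as soon as a threshold reaches 1. *)
Definition weighted_pvalues (w p : 'I_m -> R) : 'I_m -> R :=
  fun i => if 0 < w i then p i / w i else 1.

Definition shape_thresholds s (alpha : R) : nat -> R :=
  fun r => s r * alpha / m%:R.

End StepUp.

Arguments shape_thresholds {R} m s alpha.

Definition pFDR (d : measure_display) (T : measurableType d) (R : realType)
    (P : probability T R) (m : nat) (I0 : {set 'I_m}) (s t : nat -> R)
    (Q : T -> 'I_m -> R) : \bar R :=
  ('E_P[fun x => pFDP I0 s t (Q x)])%E.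

(* Main.v *)
Require Import Defs.
From HB Require Import structures.
From mathcomp Require Import all_boot all_order all_algebra.
From mathcomp Require Import all_classical all_reals all_analysis.

Import Order.TTheory GRing.Theory Num.Theory.
Import numFieldNormedType.Exports.

Local Open Scope classical_set_scope.
Local Open Scope ring_scope.

(** Write q for the weighted p-values, t for the thresholds and R for the number
    of rejections.  The penalized FDP is the sum over i in I0 and r >= 1 of
    1 / s_r times the indicator of the event that hypothesis i is rejected and
    R = r.  The key point is that this event is the intersection of
    {q_i <= t_r} with {R_i = r}, where R_i is the number of rejections after q_i
    has been replaced by 0 ([rejected_num_rejections]): as t is non-decreasing,
    once q_i <= t_r the exact value of q_i affects no comparison with a
    threshold of index at least r, and those comparisons decide whether R = r.

    Now R_i depends only on the p-values other than p_i, so the two events are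
    independent.  The product rule for boxes is enough to see this, without a
    monotone class argument: R_i depends on the other p-values through finitely
    many comparisons q_j <= t_k, hence {R_i = r} is a finite disjoint union of
    boxes ([independent_of_others]).

    Finally P(q_i <= t_r) <= w_i t_r = w_i s_r alpha / m
    ([weighted_superuniform]); the factor s_r cancels the penalty 1 / s_r, and
    the probabilities of the disjoint events {R_i = r} add up to at most 1.  So
    each null hypothesis contributes at most w_i alpha / m. *)

(** * Step-up procedures *)

Definition count_le {R : realType} {m : nat} (q : 'I_m -> R) (u : R) : nat :=
  #|[set j | q j <= u]%SET|.

(** Replaces order statistics by counts: whether a count changes when a single
    coordinate is modified is immediate, whereas the effect on the sorted
    sequence is not. *)
Lemma order_stat_le (R : realType) (m : nat) (q : 'I_m -> R) (r : nat) (u : R) :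
  (0 < r <= m)%N -> (order_stat q r <= u) = (r <= count_le q u)%N.
Proof.
case: r => // r /= rm; rewrite /order_stat /=.
have <- : count (<= u) (sort <=%R [seq q i | i : 'I_m]) = count_le q u.
  rewrite count_sort /count_le cardsE count_map cardE enumT.
  by rewrite /enum_mem size_filter.
apply/idP/idP => [|rc]; last by apply: nth_count_le rc; exact: sort_le_sorted.
apply: contraTT; rewrite -leqNgt => cr; rewrite -ltNge.
apply: nth_count_gt; first exact: sort_le_sorted.
by rewrite cr size_sort size_map size_enum_ord.
Qed.

Lemma num_rejections_leq (R : realType) (m : nat) (t : nat -> R)
  (q : 'I_m -> R) : (num_rejections t q <= m)%N.
Proof.
by apply/bigmax_leqP_seq => r; rewrite mem_index_iota ltnS => /andP[].
Qed.

(** Whether the number of rejections equals [r] is decided by the thresholds of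
    index at least [r] alone. *)
Lemma num_rejectionsP (R : realType) (m : nat) (t : nat -> R) (q : 'I_m -> R)
    (r : nat) : (0 < r <= m)%N ->
  num_rejections t q = r <->
  (r <= count_le q (t r))%N /\
  (forall r', (r < r' <= m)%N -> (count_le q (t r') < r')%N).
Proof.
move=> rm; split=> [<-|[rc rmax]].
- (* The default value 0 of the maximum satisfies the first claim trivially. *)
  set k := num_rejections t q.
  have kq : k = 0%N \/ (k <= count_le q (t k))%N.
    rewrite /k /num_rejections big_nat_cond.
    apply: (big_ind (fun k => k = 0%N \/ (k <= count_le q (t k))%N)).
    + by left.
    + by move=> a b ha hb; case: (leqP a b) => // _.
    + move=> j /andP[jm]; rewrite order_stat_le; last by [].
      by right.
  split; first by case: kq => [->|].
  move=> r' /andP[kr' r'm]; rewrite ltnNge; apply: contraL kr' => r'c.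
  rewrite -leqNgt; have [->//|r'0] := posnP r'.
  rewrite /k /num_rejections.
  apply: (@leq_bigmax_seq _ _ _ id r'); first by rewrite mem_index_iota r'0.
  by rewrite order_stat_le// r'0.
- apply/eqP; rewrite eqn_leq; apply/andP; split.
  + apply/bigmax_leqP_seq => j; rewrite mem_index_iota ltnS => jm.
    rewrite order_stat_le// leqNgt => jc; rewrite leqNgt; apply: contra jc => rj.
    by apply: rmax; rewrite rj; case/andP: jm.
  + apply: (@leq_bigmax_seq _ _ _ id r); first by rewrite mem_index_iota ltnS.
    by rewrite order_stat_le.
Qed.

Lemma eq_num_rejections (R : realType) (m : nat) (t : nat -> R)
    (q q' : 'I_m -> R) :
  (forall r, (0 < r <= m)%N -> count_le q (t r) = count_le q' (t r)) ->
  num_rejections t q = num_rejections t q'.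
Proof.
move=> qq'; rewrite /num_rejections big_nat_cond [RHS]big_nat_cond.
apply: eq_bigl => r; case rm : (0 < r < m.+1)%N => //=.
by rewrite !order_stat_le// qq'.
Qed.

(** The thresholds of index at least [r] that decide whether [r] is the number
    of rejections are all at least [t r], so they compare in the same way with
    [q i] and [q' i]. *)
Lemma num_rejections_update (R : realType) (m : nat) (t : nat -> R)
    (q q' : 'I_m -> R) (i : 'I_m) (r : nat) :
  (forall r r', (0 < r)%N -> (r <= r')%N -> (r' <= m)%N -> t r <= t r') ->
  (0 < r <= m)%N ->
  (forall j, j != i -> q j = q' j) -> q i <= t r -> q' i <= t r ->
  num_rejections t q = r -> num_rejections t q' = r.
Proof.
move=> tmono rm qq' qi qi'.
have /andP[r0 _] := rm.
have same r' : (r <= r' <= m)%N -> count_le q (t r') = count_le q' (t r').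
  move=> /andP[rr' r'm]; apply: eq_card => j; rewrite !inE.
  have [->|/qq' -> //] := eqVneq j i.
  by rewrite !(le_trans _ (tmono _ _ r0 rr' r'm)).
move=> /num_rejectionsP => /(_ rm)[rc rmax]; apply/num_rejectionsP => //.
split; first by rewrite -same// leqnn; case/andP: rm.
move=> r' /andP[rr' r'm]; rewrite -same ?(ltnW rr')//.
by apply: rmax; rewrite rr'.
Qed.

Definition zero_at {R : realType} {m : nat} (i : 'I_m) (q : 'I_m -> R) :
  'I_m -> R := fun j => if j == i then 0 else q j.

(** The right-hand side separates the roles of [q i] and of the other
    coordinates; this is what makes independence applicable. *)
Lemma rejected_num_rejections (R : realType) (m : nat) (t : nat -> R)
    (q : 'I_m -> R) (i : 'I_m) (r : nat) :
  (forall r r', (0 < r)%N -> (r <= r')%N -> (r' <= m)%N -> t r <= t r') ->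
  (0 < r <= m)%N -> 0 <= t r ->
  (i \in rejected t q) && (num_rejections t q == r)
  = (q i <= t r) && (num_rejections t (zero_at i q) == r).
Proof.
move=> tmono rm tr0; rewrite inE.
have z j : j != i -> q j = zero_at i q j by rewrite /zero_at => /negbTE ->.
have zi : zero_at i q i <= t r by rewrite /zero_at eqxx.
apply/andP/andP => [[/andP[_ qi] /eqP Rr]|[qi /eqP Rr]].
  rewrite Rr in qi; split=> //; apply/eqP.
  exact: (num_rejections_update _ _ _ _ _ _ _ tmono rm z).
have Rq : num_rejections t q = r.
  have z' j : j != i -> zero_at i q j = q j by move=> /z.
  exact: (num_rejections_update _ _ _ _ _ _ _ tmono rm z' zi qi Rr).
by rewrite Rq qi eqxx; case/andP: rm => ->.
Qed.

Lemma pFDP_sum (R : realType) (m : nat) (I0 : {set 'I_m}) (s t : nat -> R)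
    (q : 'I_m -> R) :
  (forall r r', (0 < r)%N -> (r <= r')%N -> (r' <= m)%N -> t r <= t r') ->
  (forall r, (0 < r <= m)%N -> 0 <= t r) ->
  pFDP I0 s t q =
  \sum_(i in I0) \sum_(1 <= r < m.+1) (s r)^-1 *
    ((q i <= t r) && (num_rejections t (zero_at i q) == r))%:R.
Proof.
move=> tmono t0.
have -> : \sum_(i in I0) \sum_(1 <= r < m.+1) (s r)^-1 *
    ((q i <= t r) && (num_rejections t (zero_at i q) == r))%:R
  = \sum_(i in I0) (i \in rejected t q)%:R * (s (num_rejections t q))^-1.
  apply: eq_bigr => i _.
  transitivity (\sum_(1 <= r < m.+1) (s r)^-1 *
      ((i \in rejected t q) && (num_rejections t q == r))%:R).
    apply: eq_big_nat => r rm.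
    by rewrite rejected_num_rejections// t0.
  have [irej|] /= := boolP (i \in rejected t q); last first.
    by rewrite mul0r big1// => r _; rewrite mulr0.
  have Rm : num_rejections t q \in index_iota 1 m.+1.
    rewrite mem_index_iota ltnS num_rejections_leq andbT.
    by move: irej; rewrite inE => /andP[].
  rewrite mul1r (bigD1_seq _ Rm) ?iota_uniq//= eqxx mulr1.
  by rewrite big1 ?addr0// => r /negbTE; rewrite eq_sym => ->; rewrite mulr0.
rewrite -big_distrl/= /pFDP.
have [R0|] := posnP (num_rejections t q).
  rewrite big1 ?mul0r// => i _.
  by rewrite inE R0.
move=> _; congr (_ / _); rewrite /false_positives -natr_sum; congr _%:R.
by rewrite -sum1_card big_mkcond [RHS]big_mkcond/=; apply: eq_bigr => i _;
  rewrite finset.in_setI andbC; case: (i \in I0).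
Qed.

(** * Independence *)

Section Independence.
Context (d : measure_display) (T : measurableType d) (R : realType).
Context (P : probability T R) (m : nat) (X : 'I_m -> {RV P >-> R}).
Context (indep : independent_RVs X).

Lemma measurable_box (J : {set 'I_m}) (C : 'I_m -> set R) :
  (forall j, measurable (C j)) ->
  measurable [set x | forall j, j \in J -> C j (X j x)].
Proof.
move=> mC.
have -> : [set x | forall j, j \in J -> C j (X j x)] =
    \bigcap_(j in [set` J]) (X j @^-1` C j).
  by apply/seteqP; split=> x h j /h.
by apply: fin_bigcap_measurable => // j _; apply: measurable_funPTI.
Qed.

(** The product rule applied to the index sets [J] and [i |: J]: the two
    products differ by the factor of [i]. *)
Lemma independent_box (i : 'I_m) (J : {set 'I_m}) (B : set R)
    (C : 'I_m -> set R) :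
  i \notin J -> measurable B -> (forall j, measurable (C j)) ->
  (P (X i @^-1` B `&` [set x | forall j, j \in J -> C j (X j x)])
   = P (X i @^-1` B) * P [set x | forall j, j \in J -> C j (X j x)])%E.
Proof.
move=> iJ mB mC.
pose D j := if j == i then B else C j.
have Di : D i = B by rewrite /D eqxx.
have DC j : j \in J -> D j = C j.
  by rewrite /D; have [->|//] := eqVneq j i; rewrite (negbTE iJ).
have -> : X i @^-1` B `&` [set x | forall j, j \in J -> C j (X j x)]
    = [set x | forall j, j \in (i |: J)%SET -> D j (X j x)].
  apply/seteqP; split=> x.
    move=> [Bx Cx] j; rewrite in_setU1 => /orP[/eqP ->|jJ]; first by rewrite Di.
    by rewrite DC//; exact: Cx.
  move=> h; split; first by rewrite /preimage /= -Di; apply: h; rewrite setU11.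
  by move=> j jJ; rewrite -DC//; apply: h; rewrite in_setU1 jJ orbT.
rewrite !indep//; last by move=> j; rewrite /D; case: ifP.
rewrite big_setU1//= Di; congr (_ * _)%E.
by apply: eq_bigr => j jJ; rewrite DC.
Qed.

(** An event that depends on the variables other than [X i] through finitely
    many values is a finite disjoint union of boxes not involving [i]. *)
Lemma independent_of_others (V : finType) (c : 'I_m -> R -> V) (i : 'I_m)
    (B : set R) (E : set T) :
  (forall j v, measurable (c j @^-1` [set v])) -> measurable B ->
  (forall x y, (forall j, j != i -> c j (X j x) = c j (X j y)) -> E x -> E y) ->
  measurable E /\ P (X i @^-1` B `&` E) = (P (X i @^-1` B) * P E)%E.
Proof.
move=> mc mB hE.
(* The value None at [i] makes the cells insensitive to [X i]. *)
pose cell x : {ffun 'I_m -> option V} :=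
  [ffun j => if j == i then None else Some (c j (X j x))].
pose box x0 := [set x | forall j, j \in (~: [set i])%SET ->
  (c j @^-1` [set c j (X j x0)]) (X j x)].
have cellE x0 : cell @^-1` [set cell x0] = box x0.
  apply/seteqP; split=> x /=.
    move=> /ffunP h j; rewrite in_setC1 => ji.
    by have := h j; rewrite !ffunE (negbTE ji) => -[].
  move=> h; apply/ffunP => j; rewrite !ffunE; case: ifPn => // ji.
  by congr Some; apply: h; rewrite in_setC1.
have EU : E = \bigcup_(v in cell @` E) (cell @^-1` [set v]).
  apply/seteqP; split=> x; first by move=> Ex; exists (cell x) => //; exists x.
  move=> [_ [y Ey <-] /ffunP cxy]; apply: hE Ey => j ji.
  by have := cxy j; rewrite !ffunE (negbTE ji) => -[].
have fin : finite_set (cell @` E) by exact: finite_finset.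
have mcell v : (cell @` E) v -> measurable (cell @^-1` [set v]).
  move=> [x _ <-]; rewrite cellE.
  apply: (measurable_box _ (fun j => c j @^-1` [set c j (X j x)])) => j.
  exact: (mc j _).
have mXB : measurable (X i @^-1` B) by exact: measurable_funPTI.
have mE : measurable E by rewrite EU; exact: fin_bigcup_measurable.
have triv : trivIset (cell @` E) (fun v => cell @^-1` [set v]).
  by move=> u v _ _ [x [/= <- <-]].
split=> //; rewrite EU setI_bigcupr.
rewrite measure_fin_bigcup//; last first.
- by move=> v /mcell mv; exact: measurableI.
- by apply: trivIset_setIl.
rewrite measure_fin_bigcup// ge0_mule_fsumr//.
apply: eq_fsbigr => v; rewrite inE => -[x _ <-]; rewrite cellE.
apply: (independent_box _ _ _ (fun j => c j @^-1` [set c j (X j x)])) => //.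
by rewrite in_setC1 eqxx.
Qed.

End Independence.

(** * Weighted p-values *)

Definition weighted {R : realType} (w y : R) : R := if 0 < w then y / w else 1.

Lemma measurable_weighted_le (R : realType) (w u : R) :
  measurable [set y : R | weighted w y <= u].
Proof.
rewrite /weighted; have [w0|_] := ltP 0 w; last first.
  have [u1|u1] := leP 1 u.
    by rewrite (_ : [set _ | _] = setT)//; apply/seteqP; split.
  by rewrite (_ : [set _ | _] = set0)//; apply/seteqP; split.
rewrite (_ : [set _ | _] = `]-oo, (u * w)]%classic)//.
by apply/seteqP; split=> y; rewrite /= in_itv/= ler_pdivrMr.
Qed.

(** All comparisons of a weighted p-value with the thresholds, the only
    information on it that the step-up procedure uses.  The index 0 is included
    so that [k : 'I_m.+1] is the threshold index itself, without a shift. *)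
Definition level {R : realType} (m : nat) (t : nat -> R) (w y : R) :
  {ffun 'I_m.+1 -> bool} := [ffun k : 'I_m.+1 => weighted w y <= t k].

Lemma measurable_level (R : realType) (m : nat) (t : nat -> R) (w : R)
    (v : {ffun 'I_m.+1 -> bool}) :
  measurable (level m t w @^-1` [set v]).
Proof.
have -> : level m t w @^-1` [set v] =
    \bigcap_k [set y | (weighted w y <= t (k : 'I_m.+1)) = v k].
  apply/seteqP; split=> y /=.
    by move=> <- k _; rewrite /= ffunE.
  by move=> h; apply/ffunP => k; rewrite ffunE; exact: h.
apply: fin_bigcap_measurable; first exact: finite_finset.
move=> k _; case: (v k); first exact: measurable_weighted_le.
rewrite (_ : [set _ | _] = ~` [set y | weighted w y <= t k]).
  by apply: measurableC; exact: measurable_weighted_le.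
by apply/seteqP; split=> y /=; [move=> ->|move=> /negP/negbTE].
Qed.

(** For [w = 0] the weighted p-value is 1, which exceeds [u]; for [w * u > 1],
    where super-uniformity says nothing, the bound is trivial. *)
Lemma weighted_superuniform (d : measure_display) (T : measurableType d)
    (R : realType) (P : probability T R) (X : {RV P >-> R}) (w u : R) :
  (forall u : R, 0 <= u <= 1 -> (P [set x | (X x <= u)%R] <= u%:E)%E) ->
  0 <= w -> 0 <= u -> (w = 0 -> u < 1) ->
  (P (X @^-1` [set y | (weighted w y <= u)%R]) <= (w * u)%:E)%E.
Proof.
move=> hX w0 u0 wu1.
have mE : measurable (X @^-1` [set y | weighted w y <= u]).
  by apply: measurable_funPTI; exact: measurable_weighted_le.
move: w0; rewrite le_eqVlt => /predU1P[w0|w0].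
  rewrite -w0 (_ : _ @^-1` _ = set0) ?measure0 ?mul0r//.
  apply/seteqP; split=> x //=.
  by rewrite /weighted ltxx leNgt wu1.
have [wu|wu] := leP (w * u) 1; last first.
  by rewrite (le_trans (probability_le1 _ mE))// lee_fin ltW.
rewrite (_ : _ @^-1` _ = [set x | X x <= w * u]); last first.
  by apply/seteqP; split=> x; rewrite /= /weighted w0 ler_pdivrMr// mulrC.
by apply: hX; rewrite wu mulr_ge0// ltW.
Qed.

(** * Expectation of the penalized false discovery proportion *)

Lemma sum_measure_fibres_le1 (d : measure_display) (T : measurableType d)
    (R : realType) (P : probability T R) (N : T -> nat) (m : nat) :
  (forall r, measurable (N @^-1` [set r])) ->
  (\sum_(1 <= r < m.+1) P (N @^-1` [set r]) <= 1)%E.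
Proof.
move=> mN.
rewrite fsbig_seq ?iota_uniq// -measure_fin_bigcup//.
  by apply: probability_le1; apply: fin_bigcup_measurable.
by move=> r r' _ _ [x [/= <- <-]].
Qed.

Lemma expectation_sum_indic (d : measure_display) (T : measurableType d)
    (R : realType) (P : probability T R) (I : Type) (l : seq I) (a : I -> R)
    (E : I -> set T) :
  (forall k, measurable (E k)) ->
  ('E_P[fun x => (\sum_(k <- l) a k * \1_(E k) x)%R]
   = \sum_(k <- l) (a k)%:E * P (E k))%E.
Proof.
move=> mE; rewrite unlock.
have iE k : P.-integrable setT (fun x => (\1_(E k) x)%:E).
  exact: integrable_indic.
under eq_integral do rewrite -sumEFin.
under eq_integral do under eq_bigr do rewrite EFinM.
rewrite integral_sum//; last by move=> k; exact: integrableZl.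
by apply: eq_bigr => k _; rewrite integralZl// integral_indic// setIT.
Qed.

Theorem proposition4p1 (d : measure_display) (T : measurableType d)
  (R : realType) (P : probability T R) (m : nat) (hm : (2 <= m)%N)
  (p : 'I_m -> {RV P >-> R})
  (hp01 : forall i x, 0 <= p i x <= 1)
  (I0 : {set 'I_m})
  (hnull : forall i, i \in I0 -> forall u : R, 0 <= u <= 1 ->
     (P [set x | (p i x <= u)%R] <= u%:E)%E)
  (alpha : R) (halpha : 0 < alpha)
  (s : nat -> R)
  (hs1 : 1 <= s 1%N)
  (hs_nondecr : forall r r' : nat,
     (1 <= r)%N -> (r <= r')%N -> (r' <= m)%N -> s r <= s r')
  (hsm : s m <= m%:R)
  (hindep : independent_RVs p)
  (w : 'I_m -> R)
  (hw : forall i, 0 <= w i)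
  (hw0 : forall i, i \in I0 -> w i = 0 -> shape_thresholds m s alpha m < 1) :
  (pFDR P I0 s (shape_thresholds m s alpha)
     (fun x => weighted_pvalues w (fun i => p i x))
   <= (alpha / m%:R * \sum_(i < m) w i)%:E)%E.
Proof.
set t := shape_thresholds m s alpha.
pose Q x := weighted_pvalues w (fun i => p i x).
have m0 : 0 < m%:R :> R by rewrite ltr0n (leq_trans _ hm).
have am0 : 0 <= alpha / m%:R by rewrite divr_ge0// ltW.
have s0 r : (0 < r <= m)%N -> 0 < s r.
  by move=> /andP[r0 rm]; rewrite (lt_le_trans ltr01)// (le_trans hs1)// hs_nondecr.
have tE r : t r = alpha / m%:R * s r.
  by rewrite /t /shape_thresholds -mulrA mulrC.
have tmono r r' : (0 < r)%N -> (r <= r')%N -> (r' <= m)%N -> t r <= t r'.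
  by move=> r0 rr' r'm; rewrite !tE ler_wpM2l// hs_nondecr.
have t0 r : (0 < r <= m)%N -> 0 <= t r.
  by move=> /s0 sr0; rewrite tE mulr_ge0// ltW.
pose N i x := num_rejections t (zero_at i (Q x)).
pose A i r := p i @^-1` [set y | weighted (w i) y <= t r].
have mA i r : measurable (A i r).
  by apply: measurable_funPTI; exact: measurable_weighted_le.
have AN i r : measurable (N i @^-1` [set r]) /\
    P (A i r `&` N i @^-1` [set r]) = (P (A i r) * P (N i @^-1` [set r]))%E.
  apply: (@independent_of_others _ _ _ _ _ _ hindep _
    (fun j => level m t (w j))).
  - by move=> j v; exact: measurable_level.
  - exact: measurable_weighted_le.
  (* At [i] itself both sides have the value 0. *)
  move=> x y xy /= <-; apply: eq_num_rejections => k /andP[_ km].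
  apply: eq_card => j; rewrite !inE /zero_at; case: ifPn => // /xy /ffunP.
  by move=> /(_ (inord k)); rewrite !ffunE inordK.
have mN i r : measurable (N i @^-1` [set r]) by have [] := AN i r.
have -> : pFDR P I0 s t Q = (\sum_(i in I0) \sum_(1 <= r < m.+1)
    (s r)^-1%:E * (P (A i r) * P (N i @^-1` [set r])))%E.
  (* One sum over pairs, to which linearity of the expectation applies once. *)
  rewrite -big_enum.
  rewrite -(big_allpairs (F := fun k =>
    ((s k.2)^-1%:E * (P (A k.1 k.2) * P (N k.1 @^-1` [set k.2])))%E)).
  under eq_bigr do rewrite -(AN _ _).2.
  rewrite -expectation_sum_indic; last by move=> k; exact: measurableI.
  rewrite /pFDR; congr expectation; apply/funext => x.
  rewrite pFDP_sum// big_allpairs/= big_enum/=.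
  apply: eq_bigr => i _; apply: eq_bigr => r _.
  congr (_ * _); rewrite indicE; congr (nat_of_bool _)%:R.
  apply/idP/idP => [/andP[xA /eqP xN]|]; first by apply/mem_set.
  by move=> /set_mem[/= xA xN]; apply/andP; split=> //; apply/eqP.
apply: (@le_trans _ _ (\sum_(i in I0) (alpha / m%:R * w i)%:E)%E).
  apply: lee_sum => i iI0.
  apply: (@le_trans _ _
    (\sum_(1 <= r < m.+1) (alpha / m%:R * w i)%:E * P (N i @^-1` [set r]))%E).
    rewrite big_nat_cond [leRHS]big_nat_cond.
    apply: lee_sum => r; rewrite andbT ltnS => rm.
    rewrite muleA; apply: lee_wpmul2r; first exact: measure_ge0.
    have sr0 := s0 _ rm.
    apply: (@le_trans _ _ ((s r)^-1%:E * (w i * t r)%:E)%E).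
      apply: lee_wpmul2l; first by rewrite lee_fin invr_ge0 ltW.
      apply: weighted_superuniform => //; [exact: hnull|exact: t0|].
      move=> wi0; apply: le_lt_trans (hw0 _ iI0 wi0).
      by case/andP: rm => r0 rm; exact: tmono.
    rewrite -EFinM lee_fin tE mulrCA [_ * s r]mulrC mulKf ?gt_eqF//.
    by rewrite mulrC.
  rewrite -ge0_sume_distrr; last by move=> r _; exact: measure_ge0.
  rewrite -[leRHS]mule1; apply: lee_wpmul2l; first by rewrite lee_fin mulr_ge0.
  exact: sum_measure_fibres_le1.
rewrite sumEFin lee_fin -mulr_sumr ler_wpM2l//.
rewrite big_mkcond; apply: ler_sum => i _.
by case: ifP.
Qed.
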